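(* Fix a positive integer $d$, and let $M=M(h)$ be integers with $2\leq M(h)$ and $M(h)=o(h/\log h)$ as $h\to\infty$. Let $(T_h)_{h\geq 1}$ be a sequence of trees where $T_h$ is a balanced $M$-tree of height $h$, and let $r^*=r^*(h):=\sqrt{d}/(2h)$. Then $r^*$ is a sharp threshold for $\mathcal{G}(|T_h|,r,d)$ to contain a copy of $T_h$; that is, for every fixed $\epsilon\in(0,1)$, as $h\to\infty$ the probability that $\mathcal{G}(|T_h|,r,d)$ contains a copy of $T_h$ tends to $0$ whenever $r\leq(1-\epsilon)r^*$ and tends to $1$ whenever $r\geq(1+\epsilon)r^*$.
   Context: The random geometric graph $\mathcal{G}(n,r,d)$ has as vertex set $n$ points sampled independently and uniformly at random from $[0,1]^d$, two vertices being adjacent if their Euclidean distance is at most $r$. $|T|$ denotes the number of vertices of $T$. For a rooted tree, the layer $V_i$ is the set of vertices at graph distance $i$ from the root, the height is the largest $h$ with $V_h$ nonempty, and the children of a vertex in $V_j$ are its neighbours in $V_{j+1}$. Given positive integers $h$ and $(s_i)_{i=1}^h$, the balanced tree over $(s_i)_{i=1}^h$ is the rooted tree of height $h$ in which, for each $i\in\{1,\dots,h\}$, every vertex of $V_{i-1}$ has exactly $s_i$ children. A balanced $M$-tree (of height $h$) is a balanced tree over a sequence $(s_i)_{i=1}^h$ with $s_i\in\{2,\dots,M\}$ for all $i$. *)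

(* Defs.v *)
From HB Require Import structures.
From mathcomp Require Import all_boot all_order all_algebra.
From mathcomp Require Import all_classical all_reals all_analysis.
Set Implicit Arguments. Unset Strict Implicit. Unset Printing Implicit Defensive.
Import Order.TTheory GRing.Theory Num.Theory.
Import numFieldNormedType.Exports.
Local Open Scope classical_set_scope.
Local Open Scope ring_scope.

(** * Balanced trees.
    A balanced tree over [s = [:: s_1; ...; s_h]] is represented canonically:
    its vertices are the sequences [[:: c_1; ...; c_j]] with [j <= h] and
    [c_i < s_i]; the root is [[::]], layer [V_j] is the set of such sequences
    of length [j], and the children of [u] are the [rcons u c]. *)
Fixpoint btree_layer (s : seq nat) (j : nat) : seq (seq nat) :=
  match j with
  | 0 => [:: [::]]
  | j'.+1 => [seq rcons u c | u <- btree_layer s j', c <- iota 0 (nth 0 s j')]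
  end.

Definition btree_vertices (s : seq nat) : seq (seq nat) :=
  flatten [seq btree_layer s j | j <- iota 0 (size s).+1].

Definition btree_child (u t : seq nat) : bool :=
  (size t == (size u).+1)%N && (take (size u) t == u).

Definition balanced_M_seq (M h : nat) (s : seq nat) : bool :=
  (size s == h)%N && all (fun k => (2 <= k <= M)%N) s.

Definition eucl_dist (R : realType) (n d : nat) (x : 'I_n * 'I_d -> R)
    (i j : 'I_n) : R :=
  Num.sqrt (\sum_(k < d) (x (i, k) - x (j, k)) ^+ 2).

Definition contains_tree_copy (R : realType) (n d : nat) (r : R)
    (s : seq nat) (x : 'I_n * 'I_d -> R) : Prop :=
  exists f : seq nat -> 'I_n,
    {in btree_vertices s &, injective f} /\
    forall u t, u \in btree_vertices s -> t \in btree_vertices s ->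
      btree_child u t -> eucl_dist x (f u) (f t) <= r.

(** Product of uniform [0,1] distributions on the coordinates [I -> R]
    ([I] finite), defined through iterated (Tonelli) integration with respect
    to Lebesgue measure: integrate the coordinates listed in [l] one after the
    other, the others being given by [g]. *)
Definition fupd (I : eqType) (R : Type) (g : I -> R) (i : I) (v : R) : I -> R :=
  fun j => if j == i then v else g j.

Fixpoint iter_unif (R : realType) (I : eqType) (l : seq I)
    (A : set (I -> R)) (g : I -> R) : \bar R :=
  match l with
  | [::] => (\1_A g)%:E
  | i :: l' => (\int[@lebesgue_measure R]_(v in `[0%R, 1%R]) iter_unif l' A (fupd g i v))%E
  end.

Definition unif_prob (R : realType) (I : finType) (A : set (I -> R)) : \bar R :=
  iter_unif (enum I) A (fun _ => 0).

Definition prob_tree_copy (R : realType) (d : nat) (r : R) (s : seq nat) : \bar R :=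
  let n := size (btree_vertices s) in
  unif_prob [set x : 'I_n * 'I_d -> R | contains_tree_copy r s x].

(* Main.v *)
Require Import Defs.
From HB Require Import structures.
From mathcomp Require Import all_boot all_order all_algebra.
From mathcomp Require Import all_classical all_reals all_analysis.
From mathcomp Require Import measurable_realfun zify ring lra.
Import Order.TTheory GRing.Theory Num.Theory.
Import numFieldNormedType.Exports.
Local Open Scope classical_set_scope.
Local Open Scope ring_scope.

(** Every vertex of a copy of the tree is within [h] edges of the root, so along
    the main diagonal the image has extent at most [2 h r]; it uses all the
    points, and with high probability there are points close to two opposite
    corners. This gives the lower threshold.

    For the upper one, cut the cube into [q ^ d] cells of side of order [1 / h].
    Walking at sup-norm speed [r / sqrt d], the root being at the centre, every
    cell is reached in [(1 - c) h] steps. Let the vertices of depth at most [k],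
    a small multiple of [h], stay in the central cell, give each vertex of depth
    [k] a target cell, and let its descendants walk to that target. All but a
    proportion [2 ^- k] of the vertices are then in their target cell. Ordering
    the cells so that consecutive ones are adjacent, and filling them in this
    order, each leaf can be placed in its target cell or a neighbour of it so
    that every cell gets exactly as many vertices as it has points, as soon as no
    cell has fewer than [10 n 2 ^- k] points.

    Discretising the coordinates turns the probability into a count of functions
    from points to cells. To bound the number of points in a cell from below,
    split the indices of the points into blocks of polynomial size: with high
    probability each cell is hit by each block. *)

(** * Filling ordered cells with a balanced tree *)

Section Filling.
Local Open Scope nat_scope.

Fixpoint blocks (N : nat -> nat) (Q : nat) : seq nat :=
  if Q is Q'.+1 then blocks N Q' ++ nseq (N Q') Q' else [::].

Lemma size_blocks N Q : size (blocks N Q) = \sum_(0 <= i < Q) N i.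
Proof.
elim: Q => [|Q IH] /=; first by rewrite big_nil.
by rewrite size_cat size_nseq IH big_nat_recr.
Qed.

Lemma count_blocks N Q i : i < Q -> count_mem i (blocks N Q) = N i.
Proof.
have H0 l : i <= l -> forall Q', Q' <= i -> count_mem l (blocks N Q') = 0.
  move=> il; elim=> [//|Q' IH] lt /=; rewrite count_cat IH ?(ltnW lt)// count_nseq /=.
  by rewrite (ltn_eqF (leq_trans lt il)).
elim: Q => [//|Q IH]; rewrite ltnS leq_eqVlt => /orP[/eqP<-|lt] /=.
  by rewrite count_cat count_nseq /= eqxx mul1n H0.
by rewrite count_cat IH// count_nseq /= (gtn_eqF lt) addn0.
Qed.

Lemma nth_blocks N Q x : x < \sum_(0 <= i < Q) N i ->
  let i := nth 0 (blocks N Q) x in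
  [/\ i < Q, \sum_(0 <= l < i) N l <= x & x < \sum_(0 <= l < i.+1) N l].
Proof.
elim: Q => [|Q IH]; first by rewrite big_nil.
rewrite big_nat_recr//= => lt; rewrite nth_cat size_blocks.
have [lt'|ge] := ltnP x (\sum_(0 <= i < Q) N i).
  by have [? ? ?] := IH lt'; split=> //; lia.
by rewrite nth_nseq ifT ?ltn_subLR//; split=> //; rewrite big_nat_recr.
Qed.

(** Meant for [Y = gsize k j], where [a %/ Y] is the ancestor of depth [k] of the [a]-th vertex of
    depth [j]. *)
Lemma sum_divn X Y (f : nat -> nat) : 0 < Y ->
  \sum_(0 <= a < X * Y) f (a %/ Y) = (\sum_(0 <= b < X) f b) * Y.
Proof.
move=> Y0; elim: X => [|X IH]; first by rewrite mul0n !big_nil.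
rewrite big_nat_recr//= mulnDl -IH mulSn (@big_cat_nat _ _ _ (X * Y))//= ?leq_addl//.
congr addn; rewrite -{1}[X * Y]add0n big_addn addnK.
rewrite (eq_big_nat _ _ (F2 := fun=> f X)) => [|i].
  by rewrite sum_nat_const_nat subn0 mulnC.
by move=> /andP[_ lt]; rewrite addnC divnMDl// divn_small// addn0.
Qed.

Lemma sum_lt_const P A : \sum_(0 <= b < P) (b < A : nat) = minn A P.
Proof.
elim: P => [|P IH]; first by rewrite big_nil minn0.
by rewrite big_nat_recr//= IH; case: ltnP => /=; lia.
Qed.

Lemma sum_eq_lt x i : \sum_(0 <= l < i) (x == l : nat) = (x < i).
Proof.
elim: i => [|i IH]; first by rewrite big_nil.
by rewrite big_nat_recr//= IH ltnS (leq_eqVlt x); case: ltngtP.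
Qed.

Variable sv : nat -> nat.
(* The number of descendants at depth [j] of a vertex of depth [k], where
   [sv i] is the number of children of a vertex of depth [i]. *)
Definition gsize k j := \prod_(k <= i < j) sv i.

Lemma gsizeM k l j : k <= l -> l <= j -> gsize k j = gsize k l * gsize l j.
Proof. by move=> kl lj; rewrite /gsize (@big_cat_nat _ _ _ l). Qed.

Lemma gsizenn k : gsize k k = 1.
Proof. by rewrite /gsize big_geq. Qed.

Lemma gsizeS k j : k <= j -> gsize k j.+1 = gsize k j * sv j.
Proof. by move=> kj; rewrite /gsize big_nat_recr. Qed.

Variable h : nat.
Hypothesis sv_ge2 : forall i, i < h -> 2 <= sv i.

Lemma gsize_gt0 k j : j <= h -> 0 < gsize k j.
Proof.
move=> jh; rewrite /gsize big_seq_cond prodn_cond_gt0// => i.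
by rewrite mem_index_iota => /andP[/andP[_ lt] _]; have := sv_ge2 i (leq_trans lt jh); lia.
Qed.

Lemma gsize_ge_exp k j : k <= j -> j <= h -> 2 ^ (j - k) <= gsize k j.
Proof.
elim: j => [|j IH]; first by rewrite leqn0 => /eqP->; rewrite gsizenn.
rewrite leq_eqVlt => /orP[/eqP->|]; first by rewrite subnn gsizenn.
rewrite ltnS => kj jh; rewrite gsizeS// subSn// expnSr.
by apply: leq_mul; [apply: IH => //; lia | exact: sv_ge2].
Qed.

(** Each layer is at least twice the previous one, so it outweighs all earlier ones together. *)
Lemma sum_gsize k j : k <= j -> j <= h ->
  \sum_(k <= l < j) gsize k l < gsize k j.
Proof.
elim: j => [|j IH]; first by rewrite leqn0 => /eqP->; rewrite big_nil gsizenn.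
rewrite leq_eqVlt => /orP[/eqP->|]; first by rewrite big_geq// gsizenn.
rewrite ltnS => kj jh; rewrite gsizeS// big_nat_recr//=.
have := IH kj (ltnW jh); have := sv_ge2 j jh; nia.
Qed.

(* Cells are numbered from [0] to [Q - 1] so that consecutive cells are adjacent;
   [pth i] is a route from cell [ctr] that has reached cell [i] by time [J]; cell
   [i] has to receive [N i] tree vertices. *)
Variables (k J Q ctr : nat) (adj : rel nat) (pth : nat -> nat -> nat).
Hypothesis kJ : k + J < h.
Hypothesis adj_refl : forall i, adj i i.
Hypothesis adj_succ : forall i, i.+1 < Q -> adj i i.+1 && adj i.+1 i.
Hypothesis pth0 : forall i, pth i 0 = ctr.
Hypothesis pthJ : forall i j, i < Q -> J <= j -> pth i j = i.
Hypothesis adj_pth : forall i j, i < Q -> adj (pth i j) (pth i j.+1).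
Hypothesis pth_lt : forall i j, i < Q -> pth i j < Q.

Variable N : nat -> nat.
Let n := \sum_(0 <= j < h.+1) gsize 0 j.
Let m := \sum_(k <= j < h.+1) gsize k j.
Let T := \sum_(0 <= j < k + J) gsize 0 j.
Hypothesis sumN : \sum_(0 <= i < Q) N i = n.
Hypothesis N_ge : forall i, i < Q -> 3 * m + 7 * T <= N i.

(* The [b]-th vertex of depth [k] gets the target cell [tau b], read off at the
   position of its subtree in the list of all cells with multiplicities [N].
   Internal vertices follow the route to the target of their ancestor; the
   leaves then fill the remaining places [N'] in order. *)
Let S i := \sum_(0 <= l < i) N l.
Let tau b := nth 0 (blocks N Q) (b * m).
Let Phi0 j a := pth (tau (a %/ gsize k j)) (j - k).
Let I i := \sum_(0 <= j < h) \sum_(0 <= a < gsize 0 j) (Phi0 j a == i : nat).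
Let N' i := N i - I i.
Let Phi j a := if j < h then Phi0 j a else nth 0 (blocks N' Q) a.
Let A i := minn ((S i + m.-1) %/ m) (gsize 0 k).
Let mu0 := \sum_(k <= j < k + J) gsize k j.
Let mu := \sum_(k + J <= j < h) gsize k j.
Let ell := gsize k h.

Let m_split : m = mu0 + mu + ell.
Proof.
rewrite /m big_nat_recr//=; last by lia.
by rewrite (@big_cat_nat _ _ _ (k + J))//; lia.
Qed.

Let mu_lt : mu0 + mu < ell.
Proof.
have -> : mu0 + mu = \sum_(k <= l < h) gsize k l.
  by rewrite (@big_cat_nat _ _ _ (k + J))//; lia.
by apply: sum_gsize; lia.
Qed.

Let m_gt0 : 0 < m.
Proof. by rewrite m_split; have := mu_lt; lia. Qed.

Let sum_sub k1 k2 : k <= k1 -> k2 <= h.+1 ->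
  \sum_(k1 <= j < k2) gsize 0 j = gsize 0 k * \sum_(k1 <= j < k2) gsize k j.
Proof.
move=> kk1 k2h; rewrite big_distrr/=; apply: eq_big_nat => j /andP[k1j jk2].
by rewrite (gsizeM 0 k j)//; lia.
Qed.

Let n_le : n <= gsize 0 k * m + T.
Proof.
rewrite /n (@big_cat_nat _ _ _ k)//=; last by lia.
rewrite (@sum_sub k h.+1)// addnC leq_add2l /T [leqRHS](@big_cat_nat _ _ _ k)//=; last by lia.
by rewrite leq_addr.
Qed.

Let Pm_le_n : gsize 0 k * m <= n.
Proof.
rewrite /n (@big_cat_nat _ _ _ k)//=; last by lia.
by rewrite (@sum_sub k h.+1)// leq_addl.
Qed.

Let mu0_le : gsize 0 k * mu0 <= T.
Proof.
rewrite /T (@big_cat_nat _ _ _ k)//=; last by lia.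
by rewrite (@sum_sub k (k + J))//; [rewrite leq_addl | lia].
Qed.

Let S_mono i j : i <= j -> S i <= S j.
Proof. by move=> ij; rewrite /S [leqRHS](@big_cat_nat _ _ _ i)//= leq_addr. Qed.

Let SQ : S Q = n. Proof. exact: sumN. Qed.

Let tau_spec b : b < gsize 0 k ->
  [/\ tau b < Q, S (tau b) <= b * m & b * m < S (tau b).+1].
Proof.
move=> bP; apply: nth_blocks; rewrite sumN; apply: leq_trans Pm_le_n.
by rewrite ltn_pmul2r.
Qed.

(** Targets are nondecreasing in [b], and [tau b < i] amounts to [b * m < S i]. So [A i], the
    ceiling of [S i / m] capped at the number of vertices of depth [k], counts those with target
    below [i]. *)
Let tau_lt b i : b < gsize 0 k -> i <= Q -> (tau b < i) = (b < A i).
Proof.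
move=> bP iQ; have [tQ le lt] := tau_spec b bP.
rewrite /A leq_min bP andbT leq_divRL//.
apply/idP/idP => [ti|].
  by have := S_mono (tau b).+1 i ti; rewrite mulSn; lia.
rewrite mulSn => H; rewrite ltnNge; apply/negP => it.
by have := S_mono _ _ it; lia.
Qed.

Let A_upper i : A i * m <= S i + m.
Proof.
rewrite /A; apply: (@leq_trans ((S i + m.-1) %/ m * m)).
  by rewrite leq_mul2r geq_minl orbT.
by apply: (leq_trans (leq_divM _ _)); lia.
Qed.

Let A_lower i : i <= Q -> S i <= A i * m + T.
Proof.
move=> iQ; rewrite /A; case: (leqP ((S i + m.-1) %/ m) (gsize 0 k)) => _.
  have := divn_eq (S i + m.-1) m; have := ltn_pmod (S i + m.-1) m_gt0; lia.
by have := S_mono _ _ iQ; rewrite SQ; have := n_le; lia.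
Qed.

Let A_le i : A i <= gsize 0 k. Proof. exact: geq_minr. Qed.

Let A_mono i j : i <= j -> A i <= A j.
Proof.
move=> /S_mono le; rewrite /A leq_min geq_minr andbT.
by apply: (leq_trans (geq_minl _ _)); apply: leq_div2r; lia.
Qed.

Let gsizeE j : k <= j -> j <= h -> gsize 0 j = gsize 0 k * gsize k j.
Proof. by move=> kj jh; rewrite (gsizeM 0 k j). Qed.

(* Beyond depth [k + J] an internal vertex sits at the target of its
   ancestor of depth [k], so it is counted through [A i]. *)
Let cumI i : i <= Q ->
  A i * mu <= \sum_(0 <= l < i) I l <= A i * mu + T.
Proof.
move=> iQ.
have -> : \sum_(0 <= l < i) I l =
    \sum_(0 <= j < h) \sum_(0 <= a < gsize 0 j) (Phi0 j a < i : nat).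
  rewrite exchange_big_nat/=; apply: eq_big_nat => j _.
  by rewrite exchange_big_nat/=; apply: eq_big_nat => a _; rewrite sum_eq_lt.
rewrite (@big_cat_nat _ _ _ (k + J))//=; last by lia.
have -> : \sum_(k + J <= j < h) \sum_(0 <= a < gsize 0 j) (Phi0 j a < i : nat)
    = A i * mu.
  rewrite /mu big_distrr/=; apply: eq_big_nat => j /andP[kJj jh].
  have kj : k <= j by lia.
  rewrite gsizeE//; last by lia.
  transitivity ((\sum_(0 <= b < gsize 0 k) (b < A i : nat)) * gsize k j); last first.
    by rewrite sum_lt_const (minn_idPl (A_le i)).
  rewrite -(sum_divn _ _ (fun b => (b < A i : nat))) ?gsize_gt0//; last by lia.
  apply: eq_big_nat => a /andP[_ aP].
  have bP : a %/ gsize k j < gsize 0 k by rewrite ltn_divLR// gsize_gt0//; lia.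
  have [tQ _ _] := tau_spec _ bP.
  rewrite /Phi0 (pthJ _ _ tQ) ?tau_lt//.
  by lia.
rewrite leq_addl addnC leq_add2l /T.
apply: leq_sum => j _; rewrite -[leqRHS]muln1 -[X in _ <= X * _]subn0 -sum_nat_const_nat.
by apply: leq_sum => a _; apply: leq_b1.
Qed.

Let cumI1 i : i < Q ->
  [/\ A i <= A i.+1, A i * mu + I i <= A i.+1 * mu + T,
      S i.+1 = S i + N i & 3 * m + 7 * T <= N i].
Proof.
move=> iQ; split; [exact: A_mono| |by rewrite /S big_nat_recr|exact: N_ge].
have := cumI _ (ltnW iQ); have := cumI _ iQ.
rewrite [X in _ <= X <= _ -> _]big_nat_recr//=; lia.
Qed.

(** If [D] vertices of depth [k] have target [i], then [D * m <= N i + m + T], [2 * mu <= m] and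
    [I i <= D * mu + T]. Hence [2 * I i <= N i + m + 3 * T], and [3 * m + 7 * T <= N i] is what
    leaves [m + 2 * T] free places. *)
Let I_small i : i < Q -> I i + m + 2 * T <= N i.
Proof.
move=> iQ; have [le1 le2 eS ge] := cumI1 i iQ.
have U := A_upper i.+1; have L := A_lower i (ltnW iQ).
move: (mu_lt) (m_split) => lt1 eqm.
have [D eD] : exists D, A i.+1 = A i + D by exists (A i.+1 - A i); lia.
rewrite eD in U le2.
have : D * m <= N i + m + T by nia.
have : D * (2 * mu) <= D * m by rewrite leq_mul2l; apply/orP; right; lia.
have : I i <= D * mu + T by nia.
nia.
Qed.

Let I_le_N i : i < Q -> I i <= N i. Proof. by move/I_small; lia. Qed.

Let S' i := \sum_(0 <= l < i) N' l.

(** [S i] is close to [A i * m] and the internal vertices below cell [i] number about [A i * mu].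
    The difference is [A i * ell] up to the [mu0] part, which is at most [T]. *)
Let S'_bounds i : i <= Q -> A i * ell <= S' i + m + T /\ S' i <= A i * ell + 2 * T.
Proof.
move=> iQ.
have eS : S' i + \sum_(0 <= l < i) I l = S i.
  rewrite /S' /S -big_split/=; apply: eq_big_nat => l /andP[_ li].
  by rewrite /N' subnK// I_le_N//; lia.
have := cumI i iQ; have := A_upper i; have := A_lower i iQ.
have : A i * mu0 <= T by apply: leq_trans mu0_le; rewrite leq_mul2r A_le orbT.
rewrite m_split !mulnDr; lia.
Qed.

Let S'_mono i j : i <= j -> S' i <= S' j.
Proof. by move=> ij; rewrite /S' [leqRHS](@big_cat_nat _ _ _ i)//= leq_addr. Qed.

Let S'S i : i < Q -> S' i + m + 2 * T <= S' i.+1.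
Proof.
move=> iQ; rewrite /S' big_nat_recr//= -addnA leq_add2l /N'.
by have := I_small i iQ; lia.
Qed.

Let Phi0_lt j a : j < h -> a < gsize 0 j -> Phi0 j a < Q.
Proof.
move=> jh aj; rewrite /Phi0 pth_lt//; have [kj|jk] := leqP k j.
  have /tau_spec[] // : a %/ gsize k j < gsize 0 k.
  by rewrite ltn_divLR ?gsize_gt0 -?gsizeE//; lia.
(* Above depth [k] the empty product makes [a] itself the index of a target, which has no effect
   since the time [j - k] is 0. *)
have -> : gsize k j = 1 by rewrite /gsize big_geq// ltnW.
rewrite divn1; have /tau_spec[] // : a < gsize 0 k.
apply: (leq_trans aj); rewrite (gsizeM 0 j k)//; last by lia.
by rewrite leq_pmulr// gsize_gt0//; lia.
Qed.

Let S'Q : S' Q = gsize 0 h.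
Proof.
have : S' Q + \sum_(0 <= l < Q) I l = S Q.
  rewrite /S' /S -big_split/=; apply: eq_big_nat => l /andP[_ li].
  by rewrite /N' subnK// I_le_N.
have -> : \sum_(0 <= l < Q) I l = \sum_(0 <= j < h) gsize 0 j.
  rewrite exchange_big_nat/=; apply: eq_big_nat => j /andP[_ jh].
  rewrite exchange_big_nat/= -[RHS]muln1 -[X in _ = X * _]subn0 -sum_nat_const_nat.
  apply: eq_big_nat => a /andP[_ aj]; rewrite sum_eq_lt; apply/eqP; rewrite eqb1.
  exact: Phi0_lt.
by rewrite SQ /n big_nat_recr//=; lia.
Qed.

(** [a %/ sv j] is the parent of the [a]-th vertex of layer [j.+1]. An internal edge follows a
    route; a leaf stays near its target because leaves and targets run through the cells in the same
    order. *)
Lemma balanced_tree_filling : exists Phi : nat -> nat -> nat,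
  (forall j a, j < h -> a < gsize 0 j.+1 -> adj (Phi j (a %/ sv j)) (Phi j.+1 a)) /\
  (forall i, i < Q ->
    \sum_(0 <= j < h.+1) \sum_(0 <= a < gsize 0 j) (Phi j a == i : nat) = N i) /\
  (forall j a, j <= h -> a < gsize 0 j -> Phi j a < Q).
Proof.
exists Phi; split; last split=> [i iQ|j a]; first move=> j a jh aj; last first.
- rewrite leq_eqVlt /Phi => /orP[/eqP->|jh aj]; last by rewrite jh Phi0_lt.
  by rewrite ltnn -S'Q => /nth_blocks[].
- rewrite big_nat_recr//=.
  rewrite (eq_big_nat _ _ (F2 := fun j => \sum_(0 <= a < gsize 0 j) (Phi0 j a == i : nat))).
    rewrite -/(I i) /Phi ltnn -S'Q /S' -(@size_blocks N' Q).
    rewrite -(big_nth 0 xpredT (fun x => (x == i : nat))) -big_mkcond/= sum1_count.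
    by rewrite count_blocks// /N' subnKC// I_le_N.
  by move=> j /andP[_ jh]; rewrite /Phi jh.
rewrite /Phi jh; have [kj|jk] := leqP k j; last first.
  rewrite ifT; last by lia.
  have -> : Phi0 j (a %/ sv j) = ctr by rewrite /Phi0 (_ : j - k = 0)//; lia.
  by rewrite /Phi0 (_ : j.+1 - k = 0) ?pth0//; lia.
have anc : a %/ gsize k j.+1 = a %/ sv j %/ gsize k j.
  by rewrite gsizeS// mulnC divnMA.
set b := a %/ gsize k j.+1 in anc.
have bP : b < gsize 0 k.
  by rewrite /b ltn_divLR ?gsize_gt0 -?gsizeE//; lia.
have [tQ tle tgt] := tau_spec b bP.
have [jh'|jh'] := ltnP j.+1 h.
  by rewrite /Phi0 -anc -/b subSn//; exact: adj_pth.
have ej : j.+1 = h by lia.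
(* The parent of a leaf has depth at least [k + J], hence has reached its target [tau b]. *)
rewrite /Phi0 -anc pthJ//; last by lia.
have aS : a < \sum_(0 <= i < Q) N' i by rewrite -/(S' Q) S'Q -ej.
have [iQ ile igt] := nth_blocks N' Q a aS.
rewrite -/(S' _) in ile; rewrite -/(S' _) in igt.
set i := nth 0 _ a in iQ ile igt *.
have bA : A (tau b) <= b by rewrite leqNgt -tau_lt// ?ltnn// ltnW.
have bA1 : b < A (tau b).+1 by rewrite -tau_lt.
have ba : b * ell <= a by rewrite /b ej leq_divM.
have ab : a < b.+1 * ell by rewrite /b ej ltn_ceil// gsize_gt0.
(* Were the leaf two or more cells away from its target, the remaining capacity of a cell in between
   would fit within the error of [S'_bounds], against [S'S]. *)
have H1 : tau b <= i.+1.
  rewrite leqNgt; apply/negP => lt.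
  have iQ' : i.+1 < Q by lia.
  have [lo hi] := S'_bounds (tau b) (ltnW tQ).
  have := S'_mono _ _ lt; have := S'S _ iQ'.
  have : A (tau b) * ell <= b * ell by rewrite leq_mul2r bA orbT.
  lia.
have H2 : i <= (tau b).+1.
  rewrite leqNgt; apply/negP => lt.
  have tQ' : (tau b).+1 < Q by lia.
  have [lo hi] := S'_bounds (tau b).+1 tQ.
  have := S'_mono _ _ lt; have := S'S _ tQ'.
  have : b.+1 * ell <= A (tau b).+1 * ell by rewrite leq_mul2r bA1 orbT.
  lia.
have [e|[e|e]] : tau b = i \/ (tau b = i.+1 \/ i = (tau b).+1) by lia.
- by rewrite e.
- by rewrite e in tQ *; have /andP[] := adj_succ _ tQ.
- by rewrite e in iQ *; have /andP[] := adj_succ _ iQ.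
Qed.

End Filling.

(** * Ranks of tree vertices and their placement at points *)

Section BalancedTree.
Local Open Scope nat_scope.

(** Horner evaluation in the mixed radix [sv], from depth [j] with accumulated value [acc]. *)
Fixpoint rank_from (sv : nat -> nat) (j acc : nat) (u : seq nat) : nat :=
  if u is c :: u' then rank_from sv j.+1 (acc * sv j + c) u' else acc.

Lemma rank_from_rcons sv j acc u c :
  rank_from sv j acc (rcons u c) = rank_from sv j acc u * sv (j + size u) + c.
Proof.
elim: u j acc => [|c' u IH] j acc /=; first by rewrite addn0.
by rewrite IH addnS.
Qed.

Lemma iota_rcons m n : iota m n.+1 = rcons (iota m n) (m + n).
Proof. by rewrite -addn1 iotaD cats1. Qed.

Variable s : seq nat.
Let h := size s.
Let sv i := nth 0 s i.

(* Lexicographic rank of a vertex within its layer. *)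
Definition rank (u : seq nat) := rank_from sv 0 0 u.

Lemma rank_rcons u c : rank (rcons u c) = rank u * sv (size u) + c.
Proof. by rewrite /rank rank_from_rcons. Qed.

Lemma layerP j t : t \in btree_layer s j.+1 ->
  exists u c, [/\ u \in btree_layer s j, c < sv j & t = rcons u c].
Proof.
move=> /allpairsP[[u c] /= [uj]]; rewrite mem_iota add0n => /andP[_ cj] ->.
by exists u, c.
Qed.

Lemma size_layer j u : u \in btree_layer s j -> size u = j.
Proof.
elim: j u => [|j IH] u; first by rewrite inE => /eqP->.
by move=> /layerP[v [c [/IH vj _ ->]]]; rewrite size_rcons vj.
Qed.

Lemma map_rank_layer j : map rank (btree_layer s j) = iota 0 (gsize sv 0 j).
Proof.
elim: j => [|j IH]; first by rewrite /= gsizenn.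
rewrite gsizeS// [btree_layer _ _]/= map_allpairs.
transitivity [seq a * sv j + c | a <- map rank (btree_layer s j), c <- iota 0 (sv j)].
  rewrite allpairs_mapl; apply/eq_in_allpairs => u c /size_layer uj _.
  by rewrite rank_rcons uj.
rewrite IH; elim: (gsize sv 0 j) => [//|n IHn].
rewrite iota_rcons allpairs_rcons IHn mulSn [sv j + _]addnC iotaD; congr cat.
by have := iotaDl (n * sv j) 0 (sv j); rewrite !add0n !addn0 => ->.
Qed.

Lemma mem_vertices u : (u \in btree_vertices s) = (size u <= h) && (u \in btree_layer s (size u)).
Proof.
apply/flattenP/andP => [[l /mapP[j]]|[uh ul]].
  rewrite mem_iota add0n ltnS => /andP[_ jh] -> uj.
  by rewrite (size_layer _ _ uj).
by exists (btree_layer s (size u)) => //; apply/mapP; exists (size u) => //; rewrite mem_iota.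
Qed.

Lemma count_vertices (a : nat -> nat -> bool) :
  count (fun u => a (size u) (rank u)) (btree_vertices s) =
  \sum_(0 <= j < h.+1) \sum_(0 <= b < gsize sv 0 j) a j b.
Proof.
rewrite /btree_vertices count_flatten -map_comp sumnE big_map.
rewrite {1}/index_iota subn0 -/h.
apply: eq_bigr => j _ /=; rewrite -sum1_count big_mkcond /= big_seq.
rewrite (eq_bigr (fun u => a j (rank u) : nat)) => [|u /size_layer ->]; last by case: a.
rewrite -big_seq -(big_map rank xpredT (fun b => a j b : nat)) map_rank_layer.
by rewrite /index_iota subn0.
Qed.

Lemma size_vertices : size (btree_vertices s) = \sum_(0 <= j < h.+1) gsize sv 0 j.
Proof.
rewrite -(count_predT (btree_vertices s)) (count_vertices (fun _ _ => true)).
by apply: eq_bigr => j _; rewrite sum_nat_const_nat subn0 muln1.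
Qed.

Lemma uniq_vertices : uniq (btree_vertices s).
Proof.
rewrite /btree_vertices; elim: h.+1 => [//|j IH].
rewrite iota_rcons map_rcons flatten_rcons cat_uniq IH/= add0n.
rewrite (@map_uniq _ _ rank) ?map_rank_layer ?iota_uniq// andbT.
apply/hasPn => u /size_layer uj; apply/negP => /flattenP[l /mapP[j']].
by rewrite mem_iota add0n => /andP[_ jj'] -> /size_layer; rewrite uj; lia.
Qed.

Lemma rank_lt u : u \in btree_vertices s -> rank u < gsize sv 0 (size u).
Proof.
rewrite mem_vertices => /andP[_ /(map_f rank)].
by rewrite map_rank_layer mem_iota add0n.
Qed.

Lemma child_rank u t : t \in btree_vertices s -> btree_child u t ->
  [/\ size u < h, size t = (size u).+1, rank t < gsize sv 0 (size u).+1 &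
      rank u = rank t %/ sv (size u)].
Proof.
move=> tV /andP[/eqP szt /eqP tkt]; have := rank_lt t tV; move: tV.
rewrite mem_vertices szt => /andP[uh /layerP[v [c [vl cs et]]]] rt; split=> //.
have uv : u = v.
  by rewrite -tkt et -(size_layer _ _ vl) -cats1 take_size_cat.
rewrite et rank_rcons -uv divnMDl ?divn_small ?addn0//.
exact: leq_ltn_trans cs.
Qed.

Let n := size (btree_vertices s).

(** Only multiplicities matter: a permutation between the two lists of cells pairs each vertex with
    a point of its cell. *)
Lemma perm_cells_embedding (phi : seq nat -> nat) (cell : 'I_n -> nat) :
  perm_eq (map phi (btree_vertices s)) (map cell (enum 'I_n)) ->
  exists f : seq nat -> 'I_n, {in btree_vertices s &, injective f} /\
    {in btree_vertices s, forall u, cell (f u) = phi u}.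
Proof.
move=> /(perm_iotaP 0)[Is]; rewrite size_map size_enum_ord => pIs eIs.
have szIs : size Is = n by rewrite (perm_size pIs) size_iota.
have uIs : uniq Is by rewrite (perm_uniq pIs) iota_uniq.
have ltIs l : l < n -> nth 0 Is l < n.
  move=> ln; have : nth 0 Is l \in Is by rewrite mem_nth ?szIs.
  by rewrite (perm_mem pIs) mem_iota.
have n0 : 0 < n by rewrite /n size_vertices big_nat_recl//= gsizenn.
pose f u := insubd (Ordinal n0) (nth 0 Is (index u (btree_vertices s))).
have fE u : u \in btree_vertices s -> f u = nth 0 Is (index u (btree_vertices s)) :> nat.
  by move=> uV; rewrite val_insubd ltIs// index_mem.
exists f; split=> [u v uV vV /(congr1 val)|u uV] /=.
  rewrite /= !fE// => /eqP; rewrite nth_uniq ?szIs ?index_mem// => /eqP.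
  by move=> /(congr1 (nth [::] (btree_vertices s))); rewrite !nth_index.
have iu : index u (btree_vertices s) < n by rewrite index_mem.
have := congr1 (fun l => nth 0 l (index u (btree_vertices s))) eIs.
rewrite (nth_map u 0 phi) ?nth_index// (nth_map 0) ?szIs// => ->.
by rewrite (nth_map (f u)) ?size_enum_ord ?ltIs// -fE// nth_ord_enum.
Qed.

Hypothesis s_ge2 : all (leq 2) s.

Lemma balanced_tree_embedding (k J Q ctr : nat) (adj : rel nat) (pth : nat -> nat -> nat)
  (cell : 'I_n -> nat) :
  k + J < h ->
  (forall i, adj i i) ->
  (forall i, i.+1 < Q -> adj i i.+1 && adj i.+1 i) ->
  (forall i, pth i 0 = ctr) ->
  (forall i j, i < Q -> J <= j -> pth i j = i) ->
  (forall i j, i < Q -> adj (pth i j) (pth i j.+1)) ->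
  (forall i j, i < Q -> pth i j < Q) ->
  (forall p, cell p < Q) ->
  (forall i, i < Q -> 3 * (\sum_(k <= j < h.+1) gsize sv k j) +
     7 * (\sum_(0 <= j < k + J) gsize sv 0 j) <= #|[pred p | cell p == i]|) ->
  exists f : seq nat -> 'I_n, {in btree_vertices s &, injective f} /\
    forall u t, u \in btree_vertices s -> t \in btree_vertices s ->
      btree_child u t -> adj (cell (f u)) (cell (f t)).
Proof.
move=> kJ adj_refl adj_succ pth0 pthJ adj_pth pth_lt cellQ cell_ge.
have sv2 i : i < h -> 2 <= sv i by move=> ih; move/all_nthP: s_ge2; apply.
pose N i := #|[pred p | cell p == i]|.
have NE i : N i = count_mem i (map cell (enum 'I_n)).
  rewrite /N cardE size_filter count_map enumT; apply: eq_count => p.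
  by rewrite /= inE.
have sumN : \sum_(0 <= i < Q) N i = \sum_(0 <= j < h.+1) gsize sv 0 j.
  rewrite -size_vertices -/n -[RHS]card_ord -sum1_card.
  transitivity (\sum_(0 <= i < Q) \sum_p (cell p == i : nat)).
    apply: eq_bigr => i _; rewrite /N -sum1_card big_mkcond; apply: eq_bigr => p _.
    by rewrite inE; case: eqP.
  rewrite exchange_big; apply: eq_bigr => p _.
  by rewrite sum_eq_lt cellQ.
have [Phi [Padj [PN PQ]]] := balanced_tree_filling sv h sv2 k J Q ctr adj pth kJ
  adj_refl adj_succ pth0 pthJ adj_pth pth_lt N sumN cell_ge.
have [|f [finj fcell]] := perm_cells_embedding (fun u => Phi (size u) (rank u)) cell.
  (* [perm_eq] compares the multiplicities of values occurring in either list, and these are all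
     below [Q]. *)
  apply/allP => i; rewrite mem_cat => iin; rewrite /= -NE.
  have iQ : i < Q.
    case/orP: iin => /mapP[x xin ->]; last exact: cellQ.
    move: (rank_lt x xin); move: xin; rewrite mem_vertices => /andP[xh _] rx.
    by apply: PQ.
  rewrite count_map -PN//; apply/eqP.
  exact: (count_vertices (fun j b => Phi j b == i)).
exists f; split=> // u t uV tV ut; rewrite !fcell//.
have [uh -> rt ->] := child_rank u t tV ut.
exact: Padj.
Qed.

End BalancedTree.

(** * Counting placements *)

Section Counting.
Local Open Scope nat_scope.

(** This is [(1 - 1 / Q) ^ Q <= 1 / 2], from two terms of the binomial expansion of [x.+1 ^ x.+1]
    with [x = Q.-1]. *)
Lemma double_pred_exp_le Q : 0 < Q -> (Q.-1 ^ Q).*2 <= Q ^ Q.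
Proof.
case: Q => // x _ /=.
have bern n : x ^ n.+1 + n.+1 * x ^ n <= x.+1 ^ n.+1.
  elim: n => [|n IH]; first by rewrite expn0 !expn1; lia.
  rewrite (expnS x.+1 n.+1); have := leq_mul (leqnn x.+1) IH.
  apply: leq_trans; rewrite !(expnS x); nia.
by apply: leq_trans (bern x); rewrite -addnn leq_add2l expnS leq_mul2r leqnSn orbT.
Qed.

Lemma exp_pred_mul_exp2_le Q e : 0 < Q -> Q.-1 ^ (Q * e) * 2 ^ e <= Q ^ (Q * e).
Proof.
move=> Q0; rewrite !expnM -expnMn; case: e => // e.
by rewrite leq_exp2r// muln2 double_pred_exp_le.
Qed.

Context (I1 I2 A : finType).

Definition cell_of (w : {ffun I1 * I2 -> A}) (i : I1) : {ffun I2 -> A} :=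
  [ffun k => w (i, k)].

(** After currying, a placement is an independent choice of a cell for each index, with one choice
    fewer on [S]. The factor [Q ^ #|S|] avoids the exponent [#|I1| - #|S|]. *)
Lemma card_miss (c : {ffun I2 -> A}) (S : {set I1}) :
  let Q := #|A| ^ #|I2| in
  #|[pred w | [forall (i | i \in S), cell_of w i != c]]| * Q ^ #|S| =
  Q.-1 ^ #|S| * Q ^ #|I1|.
Proof.
move=> Q.
pose curry (w : {ffun I1 * I2 -> A}) : {ffun I1 -> {ffun I2 -> A}} :=
  [ffun i => cell_of w i].
pose uncurry (g : {ffun I1 -> {ffun I2 -> A}}) : {ffun I1 * I2 -> A} :=
  [ffun p => g p.1 p.2].
have cK : cancel curry uncurry by move=> w; apply/ffunP => -[i k]; rewrite !ffunE.
have uK : cancel uncurry curry.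
  by move=> g; apply/ffunP => i; apply/ffunP => k; rewrite !ffunE.
pose F i : pred {ffun I2 -> A} := if i \in S then predC1 c else predT.
have -> : #|[pred w | [forall (i | i \in S), cell_of w i != c]]| = #|family F|.
  rewrite -(fintype.card_image (can_inj uK) (family F)); apply: eq_card => w.
  rewrite inE -[in RHS](cK w) (fintype.mem_image (can_inj uK)).
  apply/forallP/familyP => H i; have := H i; rewrite /F /curry ffunE;
    by case: (i \in S).
have cQ : #|{: {ffun I2 -> A}}| = Q by rewrite card_ffun.
rewrite card_family foldrE big_map big_enum/=.
have e i : #|F i| = if i \in S then Q.-1 else Q.
  by rewrite /F; case: (i \in S); rewrite ?cardC1 -cQ.
rewrite (eq_bigr _ (fun i _ => e i)) big_if !prod_nat_const -mulnA -expnD; congr muln.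
by congr (_ ^ _); rewrite -(cardC [in S]) addnC; congr (_ + _); apply: eq_card => i; rewrite !inE.
Qed.

End Counting.

Arguments cell_of {I1 I2 A} w i.

Section FewPoints.
Local Open Scope nat_scope.
Context (n : nat) (I2 A : finType).
Let Q := #|A| ^ #|I2|.

Lemma card_index_block B Z b : Z * B <= n -> b < Z -> 0 < B ->
  #|[set i : 'I_n | i %/ B == b]%SET| = B.
Proof.
move=> ZB bZ B0; rewrite -sum1_card (eq_bigl (fun i : 'I_n => i %/ B == b)); last first.
  by move=> i; rewrite inE.
rewrite big_mkcond -(big_mkord xpredT (fun i => if i %/ B == b then 1 else 0)).
rewrite (@big_cat_nat _ _ _ (Z * B))//= (sum_divn Z B (fun a => if a == b then 1 else 0))//.
rewrite (eq_bigr (fun a => (b == a : nat))); last by move=> a _; rewrite eq_sym; case: eqP.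
rewrite sum_eq_lt bZ mul1n big_nat_cond big1 ?addn0// => i /andP[/andP[lo _] _].
by rewrite ifF//; apply/eqP => e; move: lo; rewrite leqNgt -ltn_divLR// e bZ.
Qed.

(** A cell with fewer than [Z] points is missed by one of [Z] blocks of [Q * e] indices. For a given
    cell and block this concerns a proportion at most [2 ^- e] of the placements; a union bound over
    cells and blocks concludes. *)
Lemma card_few_points e Z : Z * (Q * e) <= n -> 0 < e -> 0 < #|A| ->
  #|[pred w : {ffun 'I_n * I2 -> A} |
     [exists c, #|[pred i | cell_of w i == c]| < Z]]| * 2 ^ e <= Q * Z * (#|A| ^ (n * #|I2|)).
Proof.
move=> ZB e0 A0; have Q0 : 0 < Q by rewrite expn_gt0 A0.
set B := Q * e; have B0 : 0 < B by rewrite muln_gt0 Q0.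
set few := [pred w | _].
pose miss (c : {ffun I2 -> A}) (b : 'I_Z) :=
  [pred w : {ffun 'I_n * I2 -> A} |
    [forall (i | i \in [set i : 'I_n | i %/ B == b]%SET), cell_of w i != c]].
have sub : #|few| <= \sum_c \sum_b #|miss c b|.
  have -> : \sum_c \sum_b #|miss c b| = \sum_w \sum_c \sum_b (w \in miss c b : nat).
    rewrite [RHS]exchange_big; apply: eq_bigr => c _.
    rewrite [RHS]exchange_big; apply: eq_bigr => b _.
    by rewrite -sum1_card big_mkcond; apply: eq_bigr => w _; case: (w \in _).
  rewrite -sum1_card big_mkcond; apply: leq_sum => w _.
  case: ifP => // /existsP[c]; rewrite ltnNge => few_c.
  have /existsP[b mb] : [exists b, w \in miss c b].
    apply: contraR few_c; rewrite negb_exists => /forallP H.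
    have ex (b : 'I_Z) : exists i : 'I_n, (i %/ B == b) && (cell_of w i == c).
      have := H b; rewrite inE negb_forall => /existsP[i]; rewrite negb_imply negbK inE.
      by exists i.
    (* Blocks are disjoint, so one hit chosen in each gives [Z] distinct points of [c]. *)
    pose g b := xchoose (ex b).
    have gP b : (g b %/ B == b) && (cell_of w (g b) == c) by exact: (xchooseP (ex b)).
    have ginj : injective g.
      move=> b b' e'; apply/val_inj => /=.
      by have /andP[/eqP eb _] := gP b; have /andP[/eqP eb' _] := gP b'; rewrite -eb -eb' e'.
    rewrite -[X in X <= _]card_ord -(fintype.card_image ginj predT).
    apply: fintype.subset_leq_card; apply/fintype.subsetP => _ /fintype.imageP[b _ ->].
    by rewrite inE; have /andP[] := gP b.
  by rewrite (bigD1 c)//= (bigD1 b)//= mb.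
have missE c b : #|miss c b| * 2 ^ e <= Q ^ n.
  have := card_miss _ _ _ c [set i : 'I_n | i %/ B == b]%SET.
  rewrite (card_index_block B Z)// card_ord -/Q /= -/(miss c b) => eq1.
  have QB : 0 < Q ^ B by rewrite expn_gt0 Q0.
  rewrite -(leq_pmul2r QB) mulnAC eq1 mulnAC [leqRHS]mulnC leq_mul2r.
  by rewrite exp_pred_mul_exp2_le ?orbT.
have : #|few| * 2 ^ e <= \sum_(c : {ffun I2 -> A}) \sum_(b < Z) Q ^ n.
  apply: leq_trans (leq_mul sub (leqnn _)) _.
  rewrite big_distrl; apply: leq_sum => c _; rewrite big_distrl.
  by apply: leq_sum => b _; exact: missE.
by rewrite !sum_nat_const card_ord card_ffun -/Q /Q -expnM [n * _]mulnC mulnA.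
Qed.

End FewPoints.

(** * The grid *)

Section Grid.
Local Open Scope nat_scope.

(* An enumeration 0, 2, 4, ..., 5, 3, 1 of [0, q[ whose cyclically consecutive
   terms differ by at most 2, so that counting in base [q] with these digits
   moves every digit by at most 2, carries included. *)
Definition zigzag (q a : nat) := if a.*2 < q then a.*2 else (q - a.+1).*2.+1.

Lemma zigzag_lt c a : a < c.*2 -> zigzag c.*2 a < c.*2.
Proof. by rewrite /zigzag; case: ifP; lia. Qed.

Lemma zigzag_inj c a b : a < c.*2 -> b < c.*2 ->
  zigzag c.*2 a = zigzag c.*2 b -> a = b.
Proof. by rewrite /zigzag; case: ifP; case: ifP; lia. Qed.

Lemma zigzag_succ c a : a.+1 < c.*2 ->
  zigzag c.*2 a <= zigzag c.*2 a.+1 + 2 /\ zigzag c.*2 a.+1 <= zigzag c.*2 a + 2.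
Proof. by rewrite /zigzag; case: ifP; case: ifP; lia. Qed.

Lemma zigzag_wrap c : 0 < c ->
  zigzag c.*2 c.*2.-1 <= zigzag c.*2 0 + 2 /\ zigzag c.*2 0 <= zigzag c.*2 c.*2.-1 + 2.
Proof. by rewrite /zigzag; case: ifP; case: ifP; lia. Qed.

Lemma modnS_cases q x : 0 < q ->
  x.+1 %% q = (x %% q).+1 \/ (x.+1 %% q = 0 /\ x %% q = q.-1).
Proof.
move=> q0; have lt := ltn_pmod x q0.
have [e|ne] := eqVneq (x %% q) q.-1; [right|left]; last first.
  by rewrite -addn1 -modnDml addn1 modn_small//; lia.
by rewrite -addn1 -modnDml addn1 e prednK// modnn.
Qed.

Lemma divnS_cases q x : 0 < q -> x.+1 %/ q = x %/ q \/ x.+1 %/ q = (x %/ q).+1.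
Proof. by move=> q0; rewrite divnS//; case: (q %| _); [right|left]. Qed.

Lemma digits_inj q d i j : i < q ^ d -> j < q ^ d ->
  (forall k, k < d -> i %/ q ^ k %% q = j %/ q ^ k %% q) -> i = j.
Proof.
elim: d i j => [|d IH] i j; first by rewrite expn0; lia.
rewrite expnSr => iq jq H; have q0 : 0 < q by case: q iq {IH H jq} => //; lia.
rewrite (divn_eq i q) (divn_eq j q); congr (_ * _ + _); last first.
  by have := H 0 isT; rewrite expn0 !divn1.
apply: IH; rewrite ?ltn_divLR// => k kd.
by have := H k.+1 kd; rewrite expnS !divnMA.
Qed.

Variables (d q' ctr t : nat).
Local Notation q := q'.+1.
Local Notation cell := {ffun 'I_d -> 'I_q}.
Hypothesis q_even : q = ctr.*2.
Hypothesis t_ge2 : 2 <= t.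

Definition close_cells (c c' : cell) :=
  [forall k, (c k <= c' k + t) && (c' k <= c k + t)].

Definition nth_cell (i : nat) : cell :=
  [ffun k : 'I_d => inord (zigzag q (i %/ q ^ k %% q))].

Lemma nth_cellE i k : nth_cell i k = zigzag q (i %/ q ^ k %% q) :> nat.
Proof. by rewrite ffunE inordK// q_even zigzag_lt// ltn_mod double_gt0; lia. Qed.

Lemma close_cells_refl c : close_cells c c.
Proof. by apply/forallP => k; rewrite leq_addr. Qed.

Lemma close_cells_sym c c' : close_cells c c' = close_cells c' c.
Proof. by apply: eq_forallb => k; rewrite andbC. Qed.

Lemma close_nth_cell i : close_cells (nth_cell i) (nth_cell i.+1).
Proof.
apply/forallP => k; rewrite !nth_cellE.
suff [H1 H2] : zigzag q (i %/ q ^ k %% q) <= zigzag q (i.+1 %/ q ^ k %% q) + 2 /\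
    zigzag q (i.+1 %/ q ^ k %% q) <= zigzag q (i %/ q ^ k %% q) + 2 by lia.
have qk : 0 < q ^ k by rewrite expn_gt0.
have [->|->] := divnS_cases (q ^ k) i qk; first by lia.
set x := i %/ q ^ k; have lt := ltn_pmod x.+1 (ltn0Sn q').
have [e|[-> ->]] := modnS_cases q x (ltn0Sn q'); rewrite q_even.
  by rewrite -q_even e; rewrite e q_even in lt; rewrite q_even; exact: zigzag_succ.
by apply: zigzag_wrap; lia.
Qed.

Lemma nth_cell_inj i j : i < q ^ d -> j < q ^ d -> nth_cell i = nth_cell j -> i = j.
Proof.
move=> iq jq e; apply: (@digits_inj q d) => // k kd.
have := congr1 (fun c : cell => nat_of_ord (c (Ordinal kd))) e.
by rewrite /= !nth_cellE /= q_even; apply: zigzag_inj; rewrite -q_even ltn_mod.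
Qed.

Lemma cell_rank_ex : exists rk : cell -> nat,
  [/\ forall c, rk c < q ^ d, cancel rk nth_cell &
      forall i, i < q ^ d -> rk (nth_cell i) = i].
Proof.
have inj : injective (fun i : 'I_(q ^ d) => nth_cell i).
  by move=> i j /nth_cell_inj e; apply/val_inj/e.
have [|g gK Kg] := inj_card_bij inj; first by rewrite card_ffun !card_ord.
exists (fun c => val (g c)); split=> [c|c|i iq]; first exact: ltn_ord.
  exact: Kg.
by have /(congr1 val) := gK (Ordinal iq).
Qed.

(** One coordinate going from [ctr] to [x] at [t] cells per step, then staying there; [maxn] absorbs
    the truncated subtraction. *)
Definition walk (x j : nat) :=
  if x <= ctr then maxn x (ctr - t * j) else minn x (ctr + t * j).

Definition walk_cell (c : cell) (j : nat) : cell := [ffun k => inord (walk (c k) j)].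

Lemma walk_cellE c j k : walk_cell c j k = walk (c k) j :> nat.
Proof.
rewrite ffunE inordK// /walk; have := ltn_ord (c k); have := q_even.
by set x := nat_of_ord (c k); case: ifP => ?; lia.
Qed.

Lemma walk_cell0 c : walk_cell c 0 = [ffun=> inord ctr].
Proof. by apply/ffunP => k; rewrite !ffunE /walk muln0; case: ifP => ?; congr inord; lia. Qed.

Lemma walk_cell_end c J j : ctr <= t * J -> J <= j -> walk_cell c j = c.
Proof.
move=> tJ Jj; have tj : ctr <= t * j by apply: leq_trans tJ _; rewrite leq_mul2l Jj orbT.
apply/ffunP => k; apply/ord_inj; rewrite walk_cellE /walk.
have := ltn_ord (c k); have := q_even.
by set x := nat_of_ord (c k); case: ifP => ?; lia.
Qed.

Lemma close_walk_cell c j : close_cells (walk_cell c j) (walk_cell c j.+1).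
Proof.
apply/forallP => k; rewrite !walk_cellE /walk mulnS.
by set x := nat_of_ord (c k); case: ifP => ?; lia.
Qed.

(** A subtree rooted at depth [k] holds at most a fraction [2 ^- k] of the tree, and so do the
    vertices of depth below [k + J], because [k.*2 + J <= size s]. With [10 = 3 + 7], cells of [Z]
    points then have the capacity that the filling requires. *)
Lemma grid_embedding (s : seq nat) (k J Z : nat) :
  let n := size (btree_vertices s) in
  forall w : 'I_n -> cell,
  all (leq 2) s -> k + J < size s -> k.*2 + J <= size s -> ctr <= t * J ->
  10 * n <= Z * 2 ^ k -> (forall c, Z <= #|[pred p | w p == c]|) ->
  exists f : seq nat -> 'I_n, {in btree_vertices s &, injective f} /\
    forall u v, u \in btree_vertices s -> v \in btree_vertices s ->
      btree_child u v -> close_cells (w (f u)) (w (f v)).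
Proof.
move=> n w s2 kJ k2J tJ nZ wZ.
have [rk [rk_lt rkK Krk]] := cell_rank_ex.
have k2 : k <= size s by lia.
have sv2 i : i < size s -> 2 <= nth 0 s i by move=> ih; move/all_nthP: s2; apply.
have size_bound : 3 * (\sum_(k <= j < (size s).+1) gsize (nth 0 s) k j) +
    7 * (\sum_(0 <= j < k + J) gsize (nth 0 s) 0 j) <= Z.
  have ek : 0 < 2 ^ k by rewrite expn_gt0.
  rewrite -(leq_pmul2r ek); apply: leq_trans nZ; rewrite /n size_vertices.
  set m := \sum_(k <= j < _) _; set T := \sum_(0 <= j < k + J) _; set N := \sum_(_ <= _ < _) _.
  have mN : m * 2 ^ k <= N.
    rewrite /N (@big_cat_nat _ _ _ k)//=; last by lia.
    apply: leq_trans (leq_addl _ _); rewrite /m big_distrl/=.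
    rewrite big_nat_cond [leqRHS]big_nat_cond; apply: leq_sum => j /andP[/andP[kj js] _].
    rewrite (gsizeM _ 0 k j)// mulnC leq_mul2r; apply/orP; right.
    by have := gsize_ge_exp _ _ sv2 0 k isT k2; rewrite subn0.
  have TN : T * 2 ^ k <= N.
    have := sum_gsize _ _ sv2 0 (k + J) isT (ltnW kJ); rewrite -/T => /ltnW Tle.
    rewrite /N big_nat_recr//=; apply: leq_trans (leq_addl _ _).
    rewrite (gsizeM _ 0 (k + J))//; last by lia.
    apply: leq_mul Tle _; apply: leq_trans (gsize_ge_exp _ _ sv2 _ _ _ _) => //; last by lia.
    by rewrite leq_exp2l//; lia.
  by rewrite mulnDl -!mulnA; lia.
have wE i p : i < q ^ d -> (rk (w p) == i) = (w p == nth_cell i).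
  by move=> iQ; apply/eqP/eqP => [<-|->]; [rewrite rkK | rewrite Krk].
have := balanced_tree_embedding s s2 k J (q ^ d) (rk [ffun=> inord ctr])
  (fun i j => close_cells (nth_cell i) (nth_cell j))
  (fun i j => rk (walk_cell (nth_cell i) j)) (fun p => rk (w p)) kJ.
case.
- by move=> i; exact: close_cells_refl.
- by move=> i _; rewrite close_nth_cell close_cells_sym close_nth_cell.
- by move=> i; rewrite walk_cell0.
- by move=> i j iQ Jj; rewrite (walk_cell_end _ J)// Krk.
- by move=> i j _; rewrite !rkK; exact: close_walk_cell.
- by move=> i j _; exact: rk_lt.
- by move=> p; exact: rk_lt.
- move=> i iQ; apply: leq_trans size_bound _; apply: leq_trans (wZ (nth_cell i)) _.
  by rewrite leq_eqVlt; apply/orP; left; apply/eqP/eq_card => p; rewrite !inE wE.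
move=> f [finj fadj]; exists f; split=> // u v uV vV uv.
by have := fadj u v uV vV uv; rewrite !rkK.
Qed.

End Grid.

(** * Discretising the uniform measure *)

(* Measurability is not needed because the integral of a nonnegative function is
   the supremum of the integrals of the simple functions below it; this spares us
   the measurability of the event that a tree is contained. *)
Lemma ge0_le_integral_nonmeasurable (d : measure_display) (T : measurableType d) (R : realType)
    (mu : {measure set T -> \bar R}) (D : set T) (f g : T -> \bar R) :
  (forall x, D x -> (0 <= f x)%E) -> (forall x, D x -> (f x <= g x)%E) ->
  (\int[mu]_(x in D) f x <= \int[mu]_(x in D) g x)%E.
Proof.
move=> f0 fg; rewrite !ge0_integralE//; last first.
  by move=> x Dx; apply: le_trans (fg _ Dx); exact: f0.
apply: le_ereal_sup => _ [/= k kf <-]; exists k => // x.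
apply: le_trans (kf x) _; rewrite /patch; case: ifPn => //.
by rewrite inE; exact: fg.
Qed.

Section UniformCube.
Context (R : realType).

(* The minimum puts the endpoint [v = 1] in the last cell. *)
Definition cell_index (q : nat) (v : R) : 'I_q.+1 :=
  inord (minn (Num.truncn (q.+1%:R * v)) q).

Lemma cell_indexP (q : nat) (v : R) : 0 <= v <= 1 ->
  (cell_index q v)%:R <= q.+1%:R * v <= (cell_index q v).+1%:R.
Proof.
move=> /andP[v0 v1]; rewrite /cell_index inordK ?ltnS ?geq_minr//.
have qv0 : 0 <= q.+1%:R * v by rewrite mulr_ge0.
have /andP[lo hi] := truncn_itv qv0.
have [le|lt] := leqP (Num.truncn (q.+1%:R * v)) q; first by rewrite lo ltW.
rewrite ler_piMr// andbT; apply: le_trans lo; rewrite ler_nat; exact: ltnW.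
Qed.

(** Only the last interval is closed on the right, so that these partition [[0, 1]]. *)
Definition cell_itv (q : nat) (a : nat) : interval R :=
  Interval (BLeft (a%:R / q.+1%:R)) (BSide (a < q)%N (a.+1%:R / q.+1%:R)).

Lemma cell_indexE (q : nat) (v : R) (a : 'I_q.+1) : 0 <= v <= 1 ->
  (cell_index q v == a) = (v \in cell_itv q a).
Proof.
move=> v01; have /andP[v0 v1] := v01.
have q0 : (0 : R) < q.+1%:R by rewrite ltr0n.
rewrite in_itv/= ler_pdivrMr// lteif_pdivlMr// [v * _]mulrC -val_eqE /= /cell_index.
rewrite inordK ?ltnS ?geq_minr//.
have qv0 : 0 <= q.+1%:R * v by rewrite mulr_ge0.
have /andP[lo hi] := truncn_itv qv0.
have aq : (a <= q)%N by rewrite -ltnS.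
have [aq'|aq'] := ltnP a q => /=.
  rewrite -truncn_eq//.
  have [le|lt] := leqP (Num.truncn (q.+1%:R * v)) q; first by [].
  by rewrite !gtn_eqF// (ltn_trans aq').
have -> : nat_of_ord a = q by apply/eqP; rewrite eqn_leq aq.
rewrite ler_piMr// andbT.
rewrite -truncn_ge_nat//; exact/eqP/minn_idPr.
Qed.

Lemma integral_cell_index (q : nat) (F : 'I_q.+1 -> R) : (forall a, 0 <= F a) ->
  (\int[@lebesgue_measure R]_(v in `[0%R, 1%R]) (F (cell_index q v))%:E =
   ((\sum_a F a) / q.+1%:R)%:E)%E.
Proof.
move=> F0.
transitivity (\int[@lebesgue_measure R]_(v in `[0%R, 1%R])
   \sum_(a <- enum 'I_q.+1) ((F a)%:E * (\1_[set` cell_itv q a] v)%:E)%E)%E.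
  apply: eq_integral => v; rewrite inE/= in_itv/= => v01.
  rewrite big_enum/= (bigD1 (cell_index q v))//= big1 => [|a ne].
    by rewrite adde0 indicE mem_set ?mule1//= -cell_indexE.
  by rewrite indicE memNset ?mule0//=; apply/negP; rewrite -cell_indexE// eq_sym.
have mitv a : measurable_fun (`[0%R, 1%R] : set R) (fun v => (\1_[set` cell_itv q a] v : R)%:E).
  by apply/measurable_EFinP; exact: measurable_indic.
rewrite ge0_integral_sum//=; last first.
- by move=> a v _; rewrite -EFinM lee_fin mulr_ge0.
- by move=> a; exact: (measurable_funeM _ (mitv a)).
rewrite big_enum/= mulr_suml -sumEFin; apply: eq_bigr => a _.
rewrite (@ge0_integralZl _ _ _ lebesgue_measure _ (measurable_itv _) _ (mitv a))//=; last first.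
  by rewrite lee_fin.
rewrite integral_indic//= setIidl; last first.
  move=> v /=; rewrite !in_itv/= => /andP[lo hi]; apply/andP; split.
    by apply: le_trans lo; rewrite divr_ge0.
  have : v <= a.+1%:R / q.+1%:R by apply: lteifW hi.
  by move/le_trans; apply; rewrite ler_pdivrMr ?ltr0n// mul1r ler_nat.
rewrite lebesgue_measure_itv/= lte_fin ltr_pM2r ?invr_gt0 ?ltr0n// ltr_nat leqnn.
by rewrite -EFinB -EFinM -mulrBl -natrB// subSnn mul1r.
Qed.

Context (I : finType).

Lemma iter_unif_ge0 (l : seq I) (A : set (I -> R)) g : (0 <= iter_unif l A g)%E.
Proof.
elim: l g => [|i l IH] g /=; first by rewrite lee_fin.
by apply: integral_ge0 => v _; exact: IH.
Qed.

Lemma le_iter_unif (l : seq I) (A B : set (I -> R)) (g : I -> R) :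
  (forall x, (forall i, 0 <= x i <= 1) -> A x -> B x) ->
  (forall i, 0 <= g i <= 1) -> (iter_unif l A g <= iter_unif l B g)%E.
Proof.
move=> AB; elim: l g => [|i l IH] g g01 /=.
  rewrite lee_fin !indicE ler_nat; case: (boolP (g \in A)) => //=.
  by rewrite inE => /(AB _ g01) Bg; rewrite mem_set.
apply: ge0_le_integral_nonmeasurable => [v _|v]; first exact: iter_unif_ge0.
rewrite /= in_itv/= => v01; apply: IH => j; rewrite /fupd.
by case: ifP.
Qed.

Definition discretize (q : nat) (x : I -> R) : {ffun I -> 'I_q.+1} :=
  [ffun i => cell_index q (x i)].

(** Integrating a coordinate averages over its cells. For the induction on [l], the coordinates
    outside [l] are pinned to the cells of [g]. *)
Lemma iter_unif_discretize (q : nat) (P : pred {ffun I -> 'I_q.+1}) (l : seq I) g :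
  uniq l -> iter_unif l [set x | P (discretize q x)] g =
  ((\sum_(w : {ffun I -> 'I_q.+1} | [forall i, (i \notin l) ==> (w i == discretize q g i)])
     (P w)%:R) / q.+1%:R ^+ size l)%:E.
Proof.
elim: l g => [|i l IH] g /=.
  move=> _; rewrite expr0 divr1; congr EFin.
  rewrite (big_pred1 (discretize q g)) => [|w].
    by rewrite indicE; congr (_ %:R); apply/congr1/asboolb.
  apply/forallP/eqP => [H|-> i]; last by rewrite eqxx.
  by apply/ffunP => i; apply/eqP; exact: H.
move=> /andP[il ul].
pose F a : R := (\sum_(w : {ffun I -> 'I_q.+1} |
   [forall j, (j \notin i :: l) ==> (w j == discretize q g j)] && (w i == a)) (P w)%:R) /
   q.+1%:R ^+ size l.
transitivity (\int[@lebesgue_measure R]_(v in `[0%R, 1%R]) (F (cell_index q v))%:E)%E.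
  apply: eq_integral => v _; rewrite IH//; congr EFin; congr (_ / _).
  apply: eq_bigl => w; apply/forallP/andP => [H|[/forallP H /eqP wi] j].
    split; last by have := H i; rewrite il /= /discretize ffunE /fupd eqxx.
    apply/forallP => j; rewrite inE negb_or; apply/implyP => /andP[ji jl].
    by have := H j; rewrite jl /discretize !ffunE /fupd (negbTE ji).
  apply/implyP => jl; rewrite /discretize ffunE /fupd; case: (eqVneq j i) => [->|ji].
    by rewrite wi.
  by have := H j; rewrite inE negb_or ji jl /= /discretize ffunE.
rewrite integral_cell_index => [|a]; last first.
  by rewrite divr_ge0 ?exprn_ge0// sumr_ge0.
rewrite -mulr_suml exprSr invfM mulrA; congr (_ / _ / _)%:E.
by rewrite (partition_big (fun w : {ffun I -> 'I_q.+1} => w i) predT).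
Qed.

Lemma unif_prob_discretize (q : nat) (P : pred {ffun I -> 'I_q.+1}) :
  unif_prob [set x : I -> R | P (discretize q x)] = (#|P|%:R / q.+1%:R ^+ #|I|)%:E.
Proof.
rewrite /unif_prob iter_unif_discretize ?enum_uniq// -cardE; congr (_ / _)%:E.
rewrite -sum1_card natr_sum [RHS]big_mkcond/=.
apply: eq_big => [w|w _]; first by apply/forallP => i; rewrite mem_enum.
by rewrite unfold_in; case: (P w).
Qed.

Lemma le_unif_prob (A B : set (I -> R)) :
  (forall x, (forall i, 0 <= x i <= 1) -> A x -> B x) ->
  (unif_prob A <= unif_prob B)%E.
Proof. by move=> AB; apply: le_iter_unif => // i; rewrite lexx ler01. Qed.

End UniformCube.

Arguments cell_index {R} q v.
Arguments discretize {R I} q x.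

(** * Probability bounds *)

Section Geometry.
Context (R : realType).

(** Cauchy-Schwarz against the constant vector, read off from the nonnegativity of the squared
    deviations from the mean [m]. *)
Lemma sqr_sum_le (d : nat) (a : 'I_d -> R) :
  (\sum_k a k) ^+ 2 <= d%:R * \sum_k a k ^+ 2.
Proof.
case: d a => [|d'] a; first by rewrite big_ord0 expr2 !mul0r.
set d := d'.+1; have dR : (0 : R) < d%:R by rewrite ltr0n.
pose m := (\sum_k a k) / d%:R.
have : 0 <= \sum_k (a k - m) ^+ 2 by apply: sumr_ge0 => k _; exact: sqr_ge0.
under eq_bigr do rewrite sqrrB.
rewrite big_split sumrB/= sumr_const card_ord sumrMnl -mulr_suml.
have -> : \sum_k a k = d%:R * m by rewrite /m mulrCA divff ?mulr1// gt_eqF.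
rewrite -[m ^+ 2 *+ _]mulr_natl => /(mulr_ge0 (ltW dR)); rewrite -/d.
by set D := d%:R; set A := \sum_k _; lra.
Qed.

(** The sum of coordinates measures position along the main diagonal, scaled by the square root of
    [d]. *)
Lemma norm_sum_le_eucl_dist (n d : nat) (x : 'I_n * 'I_d -> R) (i j : 'I_n) :
  `|\sum_k (x (i, k) - x (j, k))| <= Num.sqrt d%:R * eucl_dist x i j.
Proof.
rewrite -sqrtrM// -sqrtr_sqr ler_sqrt; first exact: sqr_sum_le.
by rewrite mulr_ge0// sumr_ge0// => k _; exact: sqr_ge0.
Qed.

Lemma eucl_dist_le (n d : nat) (x : 'I_n * 'I_d -> R) (i j : 'I_n) (c : R) :
  0 <= c -> (forall k, `|x (i, k) - x (j, k)| <= c) ->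
  eucl_dist x i j <= Num.sqrt d%:R * c.
Proof.
move=> c0 H; rewrite -[c in leRHS]ger0_norm// -sqrtr_sqr -sqrtrM// ler_wsqrtr//.
apply: (@le_trans _ _ (\sum_(k < d) c ^+ 2)).
  by apply: ler_sum => k _; rewrite -real_normK ?num_real// lerXn2r ?nnegrE.
by rewrite sumr_const card_ord mulr_natl.
Qed.

Lemma tree_copy_extent (n d : nat) (r : R) (s : seq nat) (x : 'I_n * 'I_d -> R)
    (f : seq nat -> 'I_n) :
  (forall u t, u \in btree_vertices s -> t \in btree_vertices s ->
      btree_child u t -> eucl_dist x (f u) (f t) <= r) ->
  forall u, u \in btree_vertices s ->
  `|\sum_k (x (f u, k) - x (f [::], k))| <= (size u)%:R * (Num.sqrt d%:R * r).
Proof.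
move=> fr; elim/last_ind => [|u c IH] uV.
  by rewrite big1 ?normr0 ?mul0r// => k _; rewrite subrr.
have uV' : u \in btree_vertices s.
  move: uV; rewrite !mem_vertices size_rcons => /andP[su /layerP[v [c' [vl _ /rcons_inj[-> _]]]]].
  by rewrite (size_layer _ _ _ vl) vl ltnW.
have ch : btree_child u (rcons u c).
  by rewrite /btree_child size_rcons eqxx -cats1 take_size_cat/=.
have -> : \sum_k (x (f (rcons u c), k) - x (f [::], k)) =
    \sum_k (x (f u, k) - x (f [::], k)) - \sum_k (x (f u, k) - x (f (rcons u c), k)).
  by rewrite -sumrB; apply: eq_bigr => k _; ring.
apply: le_trans (ler_normB _ _) _; rewrite size_rcons -natr1 mulrDl mul1r.
apply: lerD; first exact: IH.
apply: le_trans (norm_sum_le_eucl_dist _ _ _ _ _) _.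
by rewrite ler_wpM2l ?sqrtr_ge0//; exact: fr.
Qed.

Lemma far_points_no_tree_copy (n d q' : nat) (eps r : R) (s : seq nat)
    (x : 'I_n * 'I_d -> R) (i j : 'I_n) :
  (0 < d)%N -> (0 < size s)%N -> n = size (btree_vertices s) ->
  eps < 1 -> 2 / q'.+1%:R < eps -> r <= (1 - eps) * (Num.sqrt d%:R / (2 * (size s)%:R)) ->
  (forall p, 0 <= x p <= 1) ->
  (forall k, cell_index q' (x (i, k)) = ord0) ->
  (forall k, cell_index q' (x (j, k)) = ord_max) ->
  ~ contains_tree_copy r s x.
Proof.
move=> d0 h0 nE eps1 qeps rle x01 xi xj [f [finj fr]].
(* There are as many points as vertices, so an injective copy uses every point, the two corner ones
   included. *)
have surj l : exists2 u, u \in btree_vertices s & f u = l.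
  have [|||_ /(_ l)] := @uniq_min_size _ (map f (btree_vertices s)) (enum 'I_n).
  - by rewrite map_inj_in_uniq ?uniq_vertices.
  - by move=> ? _; rewrite mem_enum.
  - by rewrite size_enum_ord size_map nE.
  by rewrite mem_enum => /mapP[u uV ->]; exists u.
have [u uV fu] := surj i; have [v vV fv] := surj j.
have H w : w \in btree_vertices s ->
    `|\sum_k (x (f w, k) - x (f [::], k))| <= (1 - eps) * d%:R / 2.
  move=> wV.
  have hR : (0 : R) < (size s)%:R by rewrite ltr0n.
  have dE : Num.sqrt d%:R * Num.sqrt d%:R = d%:R :> R by rewrite -expr2 sqr_sqrtr.
  have wh : (size w)%:R <= (size s)%:R :> R.
    by rewrite ler_nat; move: wV; rewrite mem_vertices => /andP[].
  apply: le_trans (tree_copy_extent _ _ _ _ _ _ fr _ wV) _.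
  apply: (@le_trans _ _ ((size w)%:R * ((1 - eps) * d%:R / (2 * (size s)%:R)))).
    rewrite ler_wpM2l// -[in leRHS]dE.
    apply: (le_trans (ler_wpM2l (sqrtr_ge0 _) rle)); rewrite le_eqVlt; apply/orP; left.
    by apply/eqP; field; rewrite gt_eqF.
  have -> : (1 - eps) * d%:R / 2 = (size s)%:R * ((1 - eps) * d%:R / (2 * (size s)%:R)).
    by field; rewrite gt_eqF.
  by rewrite ler_wpM2r// divr_ge0// mulr_ge0// subr_ge0 ltW.
have Hu := H _ uV; have Hv := H _ vV; rewrite fu in Hu; rewrite fv in Hv.
have sumE : \sum_k (x (j, k) - x (i, k)) =
    \sum_k (x (j, k) - x (f [::], k)) - \sum_k (x (i, k) - x (f [::], k)).
  by rewrite -sumrB; apply: eq_bigr => k _; ring.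
have up : \sum_k (x (j, k) - x (i, k)) <= (1 - eps) * d%:R.
  rewrite sumE; apply: le_trans (ler_norm _) _; apply: le_trans (ler_normB _ _) _.
  by apply: le_trans (lerD Hv Hu) _; rewrite -splitr.
(* Each coordinate is at most [1 / q'.+1] at [i] and at least [1 - 1 / q'.+1] at [j]. *)
have lo : (1 - 2 / q'.+1%:R) * d%:R <= \sum_k (x (j, k) - x (i, k)).
  rewrite -[X in _ * X%:R]card_ord mulr_natr -sumr_const; apply: ler_sum => k _.
  have /andP[_ +] := cell_indexP _ q' _ (x01 (i, k)).
  have /andP[+ _] := cell_indexP _ q' _ (x01 (j, k)).
  rewrite xi xj /= => Hj Hi.
  have q0 : (0 : R) < q'.+1%:R by rewrite ltr0n.
  rewrite -(ler_pM2l q0) !mulrBr mulr1 mulrCA divff ?gt_eqF// mulr1.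
  have : q'%:R + 1 = q'.+1%:R :> R by rewrite natr1.
  move: Hi Hj; set A := q'.+1%:R * x (i, k); set B := q'.+1%:R * x (j, k); lra.
have dR : (0 : R) < d%:R by rewrite ltr0n.
have := le_trans lo up; rewrite ler_pM2r//. by move: qeps; set A := 2 / _; lra.
Qed.

(** Positions inside the two cells cost one more cell width, hence [t.+1]. *)
Lemma close_cells_eucl_dist (n d q' t : nat) (x : 'I_n * 'I_d -> R) (i j : 'I_n) :
  (forall p, 0 <= x p <= 1) ->
  close_cells _ _ t (cell_of (discretize q' x) i) (cell_of (discretize q' x) j) ->
  eucl_dist x i j <= Num.sqrt d%:R * (t.+1%:R / q'.+1%:R).
Proof.
move=> x01 /forallP cl; apply: eucl_dist_le => [|k]; first by rewrite divr_ge0.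
have q0 : (0 : R) < q'.+1%:R by rewrite ltr0n.
have := cl k; rewrite !ffunE => /andP[].
have /andP[] := cell_indexP _ q' _ (x01 (i, k)).
have /andP[] := cell_indexP _ q' _ (x01 (j, k)).
move: (nat_of_ord _) (nat_of_ord _) => a b j1 j2 i1 i2.
rewrite -(ler_nat R) natrD => ab; rewrite -(ler_nat R) natrD => ba.
rewrite -(ler_pM2l q0) mulrCA divff ?gt_eqF// mulr1 -[X in X * `|_|]gtr0_norm// -normrM.
rewrite ler_norml mulrBr -!natr1 in i1 i2 j1 j2 *; apply/andP; split; lra.
Qed.

Section Probability.
Variables (d q' : nat) (s : seq nat).
Let n := size (btree_vertices s).
Let Q := (q'.+1 ^ d)%N.

Lemma prob_tree_copy_le1 (r : R) : (prob_tree_copy d r s <= 1)%E.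
Proof.
rewrite /prob_tree_copy -/n.
apply: (@le_trans _ _ (unif_prob [set x : 'I_n * 'I_d -> R | predT (discretize q' x)])).
  by apply: le_unif_prob.
rewrite unif_prob_discretize lee_fin card_ffun card_ord natrX divff//.
Qed.

(** A copy forces all points to miss one of two opposite corner cells; each is missed with
    probability [(1 - 1 / Q) ^ n]. *)
Lemma prob_tree_copy_upper (eps r : R) :
  (0 < d)%N -> (0 < size s)%N -> eps < 1 -> 2 / q'.+1%:R < eps ->
  r <= (1 - eps) * (Num.sqrt d%:R / (2 * (size s)%:R)) ->
  (prob_tree_copy d r s <= (2 * (1 - Q%:R^-1) ^+ n)%:E)%E.
Proof.
move=> d0 s0 eps1 qeps rle.
pose miss (a : 'I_q'.+1) := [pred w : {ffun 'I_n * 'I_d -> 'I_q'.+1} |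
  [forall (i | i \in [set: 'I_n]%SET), cell_of w i != [ffun=> a]]].
pose P := [predU miss ord0 & miss ord_max].
apply: (@le_trans _ _ (unif_prob [set x : 'I_n * 'I_d -> R | P (discretize q' x)])).
  apply: le_unif_prob => x x01 xs; apply: contrapT => /negP.
  rewrite negb_or => /andP[].
  have hit a : ~~ miss a (discretize q' x) ->
      exists i, forall k, cell_index q' (x (i, k)) = a.
    rewrite negb_forall => /existsP[i]; rewrite negb_imply negbK => /andP[_ /eqP e].
    by exists i => k; have := congr1 (fun g : {ffun _ -> _} => g k) e; rewrite !ffunE.
  move=> /hit[i hi] /hit[j hj].
  exact: (@far_points_no_tree_copy n d q' eps r s x i j).
have Q0 : (0 < Q)%N by rewrite expn_gt0.
have cm a : (#|miss a| = Q.-1 ^ n)%N.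
  have /= := card_miss 'I_n 'I_d 'I_q'.+1 [ffun=> a] [set: 'I_n]%SET.
  rewrite cardsT !card_ord -/Q -/(miss a) => e.
  by apply/eqP; rewrite -(@eqn_pmul2r (Q ^ n)) ?expn_gt0 ?Q0// -e eqxx.
rewrite unif_prob_discretize lee_fin card_prod !card_ord mulnC exprM -natrX -/Q.
have QR : (0 : R) < Q%:R by rewrite ltr0n.
rewrite ler_pdivrMr ?exprn_gt0// -mulrA -exprMn mulrBl mul1r mulVf ?gt_eqF//.
have -> : Q%:R - 1 = Q.-1%:R :> R by rewrite -subn1 natrB.
rewrite -natrX -natrM ler_nat.
apply: (@leq_trans (#|miss ord0| + #|miss ord_max|)).
  by rewrite -cardUI leq_addr.
by rewrite !cm addnn mul2n.
Qed.

Lemma prob_tree_copy_lower (r : R) (ctr t k J e Z : nat) :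
  q'.+1 = ctr.*2 -> (2 <= t)%N -> all (leq 2) s ->
  (k + J < size s)%N -> (k.*2 + J <= size s)%N -> (ctr <= t * J)%N ->
  (10 * n <= Z * 2 ^ k)%N -> (Z * (Q * e) <= n)%N -> (0 < e)%N ->
  Num.sqrt d%:R * (t.+1%:R / q'.+1%:R) <= r ->
  ((1 - (Q * Z)%:R / 2 ^+ e)%:E <= prob_tree_copy d r s)%E.
Proof.
move=> qE t2 s2 kJ k2J ctrJ nZ Zn e0 tr.
pose few := [pred w : {ffun 'I_n * 'I_d -> 'I_q'.+1} |
  [exists c, (#|[pred i | cell_of w i == c]| < Z)%N]].
apply: (@le_trans _ _ (unif_prob [set x : 'I_n * 'I_d -> R |
    predC few (discretize q' x)])); last first.
  apply: le_unif_prob => x x01 /=; rewrite negb_exists => /forallP fewN.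
  have [|f [finj fadj]] := grid_embedding d q' ctr t qE t2 s k J Z
    (cell_of (discretize q' x)) s2 kJ k2J ctrJ nZ.
    by move=> c; have := fewN c; rewrite -leqNgt.
  exists f; split=> // u v uV vV uv.
  by apply: le_trans tr; apply: close_cells_eucl_dist => //; exact: fadj.
rewrite unif_prob_discretize lee_fin card_prod !card_ord.
have QR : (0 : R) < q'.+1%:R ^+ (n * d) by rewrite exprn_gt0// ltr0n.
have cC : (#|predC few|%:R : R) = q'.+1%:R ^+ (n * d) - #|few|%:R.
  have := cardC few; rewrite card_ffun card_prod !card_ord => /(congr1 (fun a => a%:R : R)).
  by rewrite natrD natrX => <-; rewrite addrAC subrr add0r.
rewrite cC mulrBl divff ?gt_eqF// lerB// ler_pdivrMr// mulrAC ler_pdivlMr ?exprn_gt0//.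
rewrite -!natrX -!natrM ler_nat.
by have := card_few_points n 'I_d 'I_q'.+1 e Z; rewrite !card_ord; apply.
Qed.

End Probability.
End Geometry.

(** * Growth estimates and choice of parameters *)

Section Asymptotics.
Local Open Scope nat_scope.

(** Split [2 ^ k] into two halves of exponent about [k / 2]: one absorbs degree [d], the other the
    additional factor. *)
Lemma polynomial_le_exp2 a d : exists k0, forall k, k0 <= k -> a * k.+1 ^ d <= 2 ^ k.
Proof.
elim: d a => [|d IH] a.
  by exists a => k ak; rewrite expn0 muln1; apply: leq_trans ak _; exact: ltnW (ltn_expl _ _).
have [k0 H] := IH (a * 2 ^ d.+1); exists k0.*2 => k kk0.
have /H H' : k0 <= k./2 by lia.
have le1 : k.+1 <= 2 * (k./2).+1 by lia.
apply: (@leq_trans (a * 2 ^ d.+1 * (k./2).+1 ^ d * (k./2).+1)).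
  by rewrite -!mulnA -expnSr leq_mul2l -expnMn leq_exp2r// le1 orbT.
apply: leq_trans (leq_mul H' (ltn_expl _ (ltnSn 1))) _.
by rewrite -expnD leq_exp2l//; lia.
Qed.

Lemma exp2_le_size_vertices (s : seq nat) : all (leq 2) s ->
  2 ^ size s <= size (btree_vertices s).
Proof.
move=> s2; rewrite size_vertices big_nat_recr//=; apply: leq_trans (leq_addl _ _).
have := gsize_ge_exp (nth 0 s) (size s) _ 0 (size s) isT (leqnn _).
by rewrite subn0; apply => i ih; move/all_nthP: s2; apply.
Qed.

Lemma size_vertices_le_exp2 (s : seq nat) (M : nat) :
  all (fun k => 2 <= k <= M) s -> M <= size s -> 0 < size s ->
  size (btree_vertices s) <= 2 ^ (size s * size s).
Proof.
set h := size s => sM Mh h0.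
have svM i : i < h -> 2 <= nth 0 s i <= M by move=> ih; move/all_nthP: sM; apply.
have sv2 i : i < h -> 2 <= nth 0 s i by move/svM/andP => [].
rewrite size_vertices -/h big_nat_recr//=.
have lt := sum_gsize (nth 0 s) _ sv2 0 h isT (leqnn _).
(* The exponent [h.-1] leaves room for the factor two that comes from summing the layers. *)
have le : gsize (nth 0 s) 0 h <= (2 ^ h.-1) ^ h.
  rewrite /gsize -[X in _ <= _ ^ X]subn0 -prod_nat_const_nat.
  rewrite big_nat_cond [leqRHS]big_nat_cond; apply: leq_prod => i /andP[/andP[_ ih] _].
  have /andP[_ iM] := svM i ih; apply: leq_trans (leq_trans iM Mh) _.
  by rewrite -{1}(prednK h0) ltn_expl.
apply: leq_trans (leq_add (leq_trans (ltnW lt) le) le) _; rewrite addnn -mul2n.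
rewrite -expnM -expnS leq_exp2l//; nia.
Qed.

(** The centre is [4 * K * h] cells from the boundary and a step covers [4 * K + 2] cells, so a
    proportion [1 / (2 * K + 1)] of the [h] steps is spare; [k] takes half of it. The value of [e]
    beats [Q * Z * 2 ^ h], as [Q <= 2 ^ h] and [Z <= 2 ^ (h * h)]. *)
Lemma placement_parameters d K : 0 < K -> exists h0, forall h n,
  h0 <= h -> 2 ^ h <= n -> n <= 2 ^ (h * h) ->
  let k := h %/ (2 * (2 * K + 1)) in let J := h - k.*2 in
  let Q := (8 * K * h) ^ d in let e := 2 * h * h in let Z := n %/ (Q * e) in
  [/\ k.*2 + J <= h, k + J < h, 4 * K * h <= (4 * K + 2) * J, 10 * n <= Z * 2 ^ k &
      Q * Z * 2 ^ h <= 2 ^ e].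
Proof.
move=> K0; set X := 2 * (2 * K + 1).
have X6 : 6 <= X by rewrite /X; lia.
have X0 : 0 < X by apply: leq_trans X6.
have [k0 k0P] := polynomial_le_exp2 (40 * (8 * K) ^ d * X ^ (d + 2)) (d + 2).
exists (X * k0.+1) => h n h0h nlo nhi k J Q e Z.
have kX : k * X <= h by rewrite leq_divM.
have hk : h < k.+1 * X by rewrite ltn_ceil.
have kk0 : k0 < k by rewrite /k leq_divRL// mulnC.
have h6 : 6 <= h by apply: leq_trans X6 (leq_trans _ h0h); rewrite leq_pmulr.
have h_gt0 : 0 < h by apply: leq_trans h6.
have k2h : k.*2 <= h.
  by apply: leq_trans kX; rewrite -muln2 leq_mul2l (leq_trans _ X6)// orbT.
(* The left side is polynomial in [h], and [h < k.+1 * X]. The 20 is the 10 needed per cell times 2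
   for the rounding in [Z]. *)
have B20 : 20 * (Q * e) <= 2 ^ k.
  apply: leq_trans (k0P k (ltnW kk0)).
  have -> : 20 * (Q * e) = 40 * (8 * K) ^ d * h ^ (d + 2).
    by rewrite /Q /e expnMn expnD; ring.
  by rewrite -[leqRHS]mulnA -expnMn leq_mul2l [X * _]mulnC leq_exp2r ?addn2// ltnW// orbT.
have e_gt0 : 0 < e by rewrite /e !muln_gt0 h_gt0.
have B0 : 0 < Q * e by rewrite muln_gt0 e_gt0 expn_gt0 !muln_gt0 K0 h_gt0.
have kh : 2 ^ k <= 2 ^ h by rewrite leq_exp2l// leq_div.
split.
- by rewrite subnKC.
- have aux a b : 0 < a -> a.*2 <= b -> a + (b - a.*2) < b by clear; lia.
  by apply: aux k2h; apply: leq_ltn_trans kk0.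
- have aux a b : 2 * a * (2 * K + 1) <= b -> 4 * K * b <= (4 * K + 2) * (b - a.*2).
    by clear; nia.
  by apply: aux; rewrite -mulnA mulnCA.
- have Z0 : 0 < Z.
    rewrite divn_gt0//; apply: leq_trans (leq_trans kh nlo).
    by apply: leq_trans B20; rewrite leq_pmull.
  have nZ : n < Z.+1 * (Q * e) by rewrite ltn_ceil.
  apply: leq_trans (leq_mul (leqnn Z) B20).
  have aux a b : 0 < a -> n < a.+1 * b -> 10 * n <= a * (20 * b) by clear; nia.
  exact: aux.
- have Zn : Z <= n by exact: leq_div.
  have Qk : Q <= 2 ^ h.
    by apply: leq_trans kh; apply: leq_trans B20; rewrite mulnCA leq_pmulr// muln_gt0.
  apply: leq_trans (leq_mul (leq_mul Qk (leq_trans Zn nhi)) (leqnn _)) _.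
  have hh : h + h <= h * h.
    by rewrite addnn -mul2n leq_mul2r (leq_trans _ h6)// orbT.
  have aux a b : a + a <= b -> a + b + a <= 2 * b by clear; lia.
  by rewrite -!expnD leq_exp2l// /e -mulnA aux.
Qed.

End Asymptotics.

(** * The limits below and above the threshold *)

Theorem theorem1p2 (R : realType) (d : nat) (hd : (0 < d)%N)
  (M : nat -> nat) (HM2 : forall h, (2 <= M h)%N)
  (HMo : (fun h : nat => (M h)%:R : R) =o_\oo (fun h : nat => h%:R / ln (h%:R : R)))
  (s : nat -> seq nat) (Hs : forall h, (1 <= h)%N -> balanced_M_seq (M h) h (s h))
  (eps : R) (Heps : 0 < eps < 1) :
  let rstar := fun h : nat => Num.sqrt (d%:R) / (2 * h%:R) in
  (forall r : nat -> R, (\forall h \near \oo, r h <= (1 - eps) * rstar h) ->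
     (fun h => prob_tree_copy d (r h) (s h)) @ \oo --> (0 : R)%:E) /\
  (forall r : nat -> R, (\forall h \near \oo, r h >= (1 + eps) * rstar h) ->
     (fun h => prob_tree_copy d (r h) (s h)) @ \oo --> (1 : R)%:E).
Proof.
move=> rstar; have /andP[eps0 eps1] := Heps.
have sP h : (0 < h)%N -> [/\ size (s h) = h, all (leq 2) (s h) &
    all (fun k => 2 <= k <= M h)%N (s h)].
  move=> h0; have /andP[/eqP sz al] := Hs h h0; split=> //.
  by apply: sub_all al => k /andP[].
split=> r rh.
(* Below the threshold a grid independent of [h] suffices; [z] is the chance that a point misses a
   given cell. *)
- pose q' := Num.truncn (2 / eps).
  have q'P : 2 / q'.+1%:R < eps.
    by rewrite ltr_pdivrMr ?ltr0n// mulrC -ltr_pdivrMr// truncnS_gt.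
  pose z : R := 1 - (q'.+1 ^ d)%:R^-1.
  have QR : (1 : R) <= (q'.+1 ^ d)%:R by rewrite ler1n expn_gt0.
  have z0 : 0 <= z by rewrite subr_ge0 invf_le1// (lt_le_trans ltr01).
  have z1 : z < 1 by rewrite gtrBl invr_gt0 (lt_le_trans ltr01).
  apply: (@squeeze_cvge _ _ _ _ (cst 0%E) _ (fun h => (2 * z ^+ h)%:E)).
  + near=> h.
    have h0 : (0 < h)%N by near: h; exact: nbhs_infty_gt.
    have [sz s2 _] := sP h h0; rewrite iter_unif_ge0/=.
    apply: (@le_trans _ _ (2 * z ^+ size (btree_vertices (s h)))%:E).
      apply: (prob_tree_copy_upper _ d q' (s h) eps) => //; first by rewrite sz.
      by rewrite sz; near: h.
    rewrite lee_fin ler_pM2l//; apply: ler_wiXn2l; [exact: z0|exact: ltW|].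
    apply: leq_trans (exp2_le_size_vertices _ s2).
    by rewrite sz; exact: ltnW (ltn_expl _ _).
  + exact: cvg_cst.
  + apply: cvg_EFin; first by near=> h.
    rewrite -(mulr0 2); apply: cvgMl_tmp; apply: cvg_expr; by rewrite ger0_norm.
(* With cells of side [1 / (8 * K * h)], an edge spans at most [4 * K + 3] of them per coordinate.
   This fits within [(1 + eps) / (2 * h)] once [3 <= 4 * K * eps]. *)
- pose K := (Num.truncn eps^-1).+1.
  have KE : 1 <= K%:R * eps.
    by rewrite -ler_pdivrMr// mul1r ltW// truncnS_gt.
  have [h0 h0P] := placement_parameters d K isT.
  (* The little-o with constant 1, together with [ln h >= 1]; it serves to bound [n] by
     [2 ^ (h * h)]. *)
  have HM : \forall h \near \oo, (M h <= h)%N.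
    have /eqoP/(_ _ ltr01) o1 := HMo.
    near=> h.
    have h_gt0 : (0 : R) < h%:R by rewrite ltr0n; near: h; exact: nbhs_infty_gt.
    have ln1 : 1 <= ln (h%:R : R).
      have he : expR 1 <= h%:R :> R by near: h; exact: nbhs_infty_ger.
      by rewrite -[leLHS]expRK ler_ln ?posrE ?expR_gt0.
    rewrite -(ler_nat R) -[(M h)%:R]ger0_norm//.
    apply: (@le_trans _ _ (1 * `|h%:R / ln h%:R|)).
      by near: h; exact: o1.
    have ln0 : 0 < ln (h%:R : R) by apply: lt_le_trans ln1.
    rewrite mul1r ger0_norm; last by rewrite divr_ge0// ltW.
    by rewrite ler_pdivrMr// ler_peMr// ltW.
  apply: (@squeeze_cvge _ _ _ _ (fun h => (1 - (2^-1) ^+ h)%:E) _ (cst 1%E)).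
  + near=> h.
    apply/andP; split; last exact: prob_tree_copy_le1.
    have h1 : (0 < h)%N by near: h; exact: nbhs_infty_gt.
    have Mh : (M h <= h)%N by near: h.
    have rle : (1 + eps) * rstar h <= r h by near: h.
    have [sz s2 sM] := sP h h1.
    have := h0P h (size (btree_vertices (s h))).
    have nlo := exp2_le_size_vertices _ s2; rewrite sz in nlo.
    have := size_vertices_le_exp2 _ _ sM; rewrite sz => /(_ Mh h1) nhi.
    have hh0 : (h0 <= h)%N by near: h; exact: nbhs_infty_ge.
    move=> /(_ hh0 nlo nhi) /=.
    set k := (h %/ _)%N; set J := (h - k.*2)%N; set e := (2 * h * h)%N.
    set Z := (_ %/ _)%N => -[k2J kJ tJ nZ QZ].
    have q'E : (8 * K * h).-1.+1 = (8 * K * h)%N by rewrite prednK// !muln_gt0 h1.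
    have qE : (8 * K * h).-1.+1 = (4 * K * h).*2 by rewrite q'E doubleMl doubleMl.
    have t2 : (2 <= 4 * K + 2)%N by exact: leq_addl.
    have lower := prob_tree_copy_lower R d (8 * K * h).-1 (s h) (r h) (4 * K * h)
      (4 * K + 2) k J e Z qE t2 s2.
    rewrite sz q'E in lower.
    apply: le_trans (lower kJ k2J tJ nZ _ _ _).
    * rewrite lee_fin lerB// ler_pdivrMr ?exprn_gt0// exprVn mulrC ler_pdivlMr ?exprn_gt0//.
      by rewrite -!natrX -natrM ler_nat.
    * exact: leq_divM.
    * by rewrite !muln_gt0 h1.
    * apply: le_trans rle; rewrite /rstar [leRHS]mulrCA ler_wpM2l ?sqrtr_ge0//.
      have hR : (0 : R) < h%:R by rewrite ltr0n.
      have KR : (0 : R) < K%:R by rewrite ltr0n.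
      rewrite ler_pdivrMr ?ltr0n ?muln_gt0 ?h1// !natrM.
      have -> : (1 + eps) / (2 * h%:R) * (8 * K%:R * h%:R) = 4 * (K%:R + K%:R * eps).
        by field; rewrite gt_eqF.
      rewrite -natr1 natrD natrM; lra.
  + apply: cvg_EFin; first by near=> h.
    rewrite -[X in _ --> X]subr0; apply: cvgB; first exact: cvg_cst.
    by apply: cvg_expr; rewrite ger0_norm ?invr_ge0// invf_lt1// ltr1n.
  + exact: cvg_cst.
Unshelve. all: by end_near.
Qed.
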